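(* Let $p$ be an odd prime and let $K$ be an imaginary quadratic field in which $p$ splits into two primes $\mathfrak{p},\overline{\mathfrak{p}}$. Let $L$ be an abelian extension of $K$ which is a finite extension of $\widetilde{K}$, the $\mathbb{Z}_p^2$-extension of $K$. Let $\Sigma$ be a finite set of places of $K$ containing all primes above $p$ and all primes ramified in $L/K$, and put $\Sigma_0=\Sigma\setminus\{\overline{\mathfrak p}\}$. Then for any quasi-Fitting invariant $\mathcal{F}:\mathcal{C}\to\Omega$ and any $n\in\mathbb{Z}$, we have \[ \mathcal{F}^{\langle n\rangle}(X_{\Sigma_0}(L))=\mathcal{F}(\Phi_{L/K,\Sigma_0})^{(-1)^n}\,\mathcal{F}^{\langle n+2\rangle}(\mathbb{Z}_p). \] In particular, \[ \mathcal{F}(X_{\Sigma_0}(L))=\mathcal{F}(\Phi_{L/K,\Sigma_0})\,\mathcal{F}^{\langle2\rangle}(\mathbb{Z}_p). \]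
   Context: $G=\mathrm{Gal}(L/K)$, $R=\mathbb Z_p[[G]]$, $G'\simeq\mathbb Z_p^2$ an open subgroup of $G$, $\Lambda=\mathbb Z_p[[G']]$, $S=\Lambda\setminus\{0\}$. $X_{\Sigma_0}(L)$ is the Galois group of the maximal abelian pro-$p$ extension of $L$ unramified outside $\Sigma_0$. $\mathbb Z_p$ carries the trivial action. Categories. $\mathcal M$: finitely generated $S$-torsion $R$-modules; $\mathcal C=\{M\in\mathcal M\mid\mathrm{Ext}^i_R(M,R)=0\text{ for all }i\ge2\}$; $\mathcal P=\{P\in\mathcal M\mid\mathrm{pd}_R(P)\le1\}$; $\mathcal Q=\{M\in\mathcal M\mid\mathrm{pd}_R(M)<\infty\}$. A quasi-Fitting invariant is a map $\mathcal F$ from (objects of) $\mathcal C$ to a commutative monoid $\Omega$ such that: (i) $\mathcal F(P)\in\Omega^\times$ for $P\in\mathcal P$; (ii) $\mathcal F(M)=\mathcal F(P)\mathcal F(M')$ for each exact sequence $0\to M'\to M\to P\to0$ in $\mathcal C$ with $P\in\mathcal P$; (iii) $\mathcal F(M)=\mathcal F(P)\mathcal F(M')$ for each exact sequence $0\to P\to M\to M'\to0$ in $\mathcal C$ with $P\in\mathcal P$. It induces a homomorphism $\mathcal F:K_0(\mathcal P)\to\Omega^\times$. Shifts. $\{\mathcal F^{\langle n\rangle}:\mathcal M\to\Omega\}_{n\in\mathbb Z}$ is the unique family of maps such that: $\mathcal F^{\langle0\rangle}$ extends $\mathcal F$; $\mathcal F^{\langle n\rangle}(P)\in\Omega^\times$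 for $P\in\mathcal Q$; and for all $n$ and all $P\in\mathcal Q$: $\mathcal F^{\langle n\rangle}(M)=\mathcal F^{\langle n\rangle}(P)\mathcal F^{\langle n-1\rangle}(N)$ for each exact sequence $0\to N\to P\to M\to0$ in $\mathcal M$, $\mathcal F^{\langle n\rangle}(M)=\mathcal F^{\langle n\rangle}(P)\mathcal F^{\langle n\rangle}(M')$ for each exact sequence $0\to M'\to M\to P\to0$ in $\mathcal M$, and $\mathcal F^{\langle n\rangle}(M)=\mathcal F^{\langle n\rangle}(P)\mathcal F^{\langle n\rangle}(M')$ for each exact sequence $0\to P\to M\to M'\to0$ in $\mathcal M$. (Such a family exists and is unique.) One has $X_{\Sigma_0}(L)\in\mathcal C$ and there is an exact sequence $0\to X_{\Sigma_0}(L)\to P_1\to P_2\to\mathbb Z_p\to0$ in $\mathcal M$ with $P_1,P_2\in\mathcal P$; using it, put $\Phi_{L/K,\Sigma_0}=[P_1]-[P_2]\in K_0(\mathcal P)$, where $K_0(\mathcal P)$ is the Grothendieck group of the exact category $\mathcal P$. *)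

(* Defs.v *)
From HB Require Import structures.
From mathcomp Require Import all_boot all_order all_algebra all_field.
From mathcomp Require Import all_classical.
From mathcomp Require Import topology.

Set Implicit Arguments.
Unset Strict Implicit.
Unset Printing Implicit Defensive.

Import Order.TTheory GRing.Theory Num.Theory.

Local Open Scope classical_set_scope.
Local Open Scope ring_scope.

(* Z_p is the inverse limit of the rings Z/p^n; the class modulo p^n is
   represented by its least nonnegative residue. *)
Record Zp (p : nat) := MkZp {
  zp_res :> nat -> int;
  zp_compat : forall n, zp_res n = (zp_res n.+1 %% (p ^ n)%N)%Z }.

Section ZpRing.
Variable p : nat.
Implicit Types a b c : Zp p.
Local Notation md m n := (modz m (p ^ n)%N).

Lemma zp_ext a b : a =1 b -> a = b.
Proof.
case: a b => [a ha] [b hb] /= /funext ab; move: ha hb; rewrite ab => ha hb.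
by congr MkZp; exact: Prop_irrelevance.
Qed.

HB.instance Definition _ := gen_eqMixin (Zp p).
HB.instance Definition _ := gen_choiceMixin (Zp p).

Lemma zp_mod a n : md (a n) n = a n.
Proof. by rewrite zp_compat modz_mod. Qed.

Lemma zp_modS (m : int) n : md (md m n.+1) n = md m n.
Proof.
by rewrite [in RHS](divz_eq m (p ^ n.+1)%N) {3}expnS PoszM mulrA modzMDl.
Qed.

Fact zp_of_subproof (f : nat -> int)
    (hf : forall n, md (f n) n = md (f n.+1) n) n :
  md (f n) n = md (md (f n.+1) n.+1) n.
Proof. by rewrite zp_modS hf. Qed.

Definition zp_of f hf : Zp p := MkZp (@zp_of_subproof f hf).

Fact zp_add_subproof a b n :
  md (a n + b n) n = md (a n.+1 + b n.+1) n.
Proof. by rewrite !(zp_compat _ n) modzDm. Qed.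
Fact zp_mul_subproof a b n :
  md (a n * b n) n = md (a n.+1 * b n.+1) n.
Proof. by rewrite !(zp_compat _ n) modzMm. Qed.
Fact zp_opp_subproof a n : md (- a n) n = md (- a n.+1) n.
Proof. by rewrite !(zp_compat _ n) modzNm. Qed.
Fact zp_cst_subproof (m : int) n : md m n = md m n.
Proof. by []. Qed.

Definition zp_add a b := zp_of (@zp_add_subproof a b).
Definition zp_mul a b := zp_of (@zp_mul_subproof a b).
Definition zp_opp a := zp_of (@zp_opp_subproof a).
Definition zp_cst m := zp_of (zp_cst_subproof m).

Fact zp_addA : associative zp_add.
Proof. by move=> a b c; apply: zp_ext => n /=; rewrite modzDml modzDmr addrA. Qed.
Fact zp_addC : commutative zp_add.
Proof. by move=> a b; apply: zp_ext => n /=; rewrite addrC. Qed.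
Fact zp_add0 : left_id (zp_cst 0) zp_add.
Proof. by move=> a; apply: zp_ext => n /=; rewrite mod0z add0r zp_mod. Qed.
Fact zp_addN : left_inverse (zp_cst 0) zp_opp zp_add.
Proof. by move=> a; apply: zp_ext => n /=; rewrite modzDml addNr. Qed.
HB.instance Definition _ :=
  GRing.isZmodule.Build (Zp p) zp_addA zp_addC zp_add0 zp_addN.

Fact zp_mulA : associative zp_mul.
Proof. by move=> a b c; apply: zp_ext => n /=; rewrite modzMml modzMmr mulrA. Qed.
Fact zp_mulC : commutative zp_mul.
Proof. by move=> a b; apply: zp_ext => n /=; rewrite mulrC. Qed.
Fact zp_mul1 : left_id (zp_cst 1) zp_mul.
Proof. by move=> a; apply: zp_ext => n /=; rewrite modzMml mul1r zp_mod. Qed.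
Fact zp_mulDl : left_distributive zp_mul +%R.
Proof.
by move=> a b c; apply: zp_ext => n /=; rewrite modzMml modzDm mulrDl.
Qed.
HB.instance Definition _ :=
  GRing.Zmodule_isComPzRing.Build (Zp p) zp_mulA zp_mulC zp_mul1 zp_mulDl.

HB.instance Definition _ := Topological.copy (Zp p)
  (initial_topology (@zp_res p : Zp p -> {ptws nat -> discrete_topology int})).
End ZpRing.

#[short(type="topGroupType")]
HB.structure Definition TopGroup := {G of Topological G & Group G}.

Definition subgroup_set (G : groupType) (H : set G) : Prop :=
  [/\ H 1%g, forall x y, H x -> H y -> H (x * y)%g & forall x, H x -> H x^-1%g].

Record subgroup (G : groupType) := Subgroup {
  subgroup_val :> set G;
  subgroupP : subgroup_set subgroup_val }.

Definition subg (G : groupType) (H : subgroup G) : Type := set_type H.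

Section SubgroupType.
Variables (G : groupType) (H : subgroup G).
HB.instance Definition _ := SubChoice.on (subg H).
Fact subg_closed : group_closed (fun x : G => x \in (H : set G)).
Proof.
have [H1 HM HV] := subgroupP H; split; first exact/mem_set.
by move=> x y; rewrite !unfold_in /= => /set_mem Hx /set_mem Hy;
  exact/mem_set/HM/HV.
Qed.
HB.instance Definition _ :=
  SubChoice_isSubGroup.Build G (fun x => x \in (H : set G)) (subg H) subg_closed.
End SubgroupType.
HB.instance Definition _ (G : topGroupType) (H : subgroup G) :=
  Topological.copy (subg H) (set_type H).

(* xH = yH *)
Definition same_coset (G : groupType) (H : set G) (x y : G) : bool :=
  `[< H (x^-1 * y)%g >].

(* For profinite G the finiteness of the index is automatic. *)
Record openNormal (G : topGroupType) := OpenNormal {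
  on_set :> set G;
  on_open : open on_set;
  on_subgroup : subgroup_set on_set;
  on_normal : forall x y, on_set x -> on_set (x ^ y)%g;
  on_findex : exists s : seq G, forall x, exists2 y, y \in s & same_coset on_set y x }.

(* s lists representatives of the cosets xU, one for each *)
Definition transversal (G : groupType) (U : set G) (s : seq G) : Prop :=
  [/\ uniq s, {in s &, forall y z, same_coset U y z -> y = z} &
      forall x, exists2 y, y \in s & same_coset U y x].

Section Cosets.
Variables (G : groupType) (U : set G).
Hypothesis sU : subgroup_set U.

Lemma sc_refl x : same_coset U x x.
Proof. by case: sU => U1 _ _; apply/asboolP; rewrite mulVg. Qed.

Lemma sc_sym x y : same_coset U x y = same_coset U y x.
Proof.
case: sU => _ _ UV.
by apply: asbool_equiv_eq; split=> /UV; rewrite invgM invgK.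
Qed.

Lemma sc_trans y x z : same_coset U x y -> same_coset U y z -> same_coset U x z.
Proof.
case: sU => _ UM _ /asboolP Uxy /asboolP Uyz; apply/asboolP.
by have := UM _ _ Uxy Uyz; rewrite mulgA mulgK.
Qed.

Lemma sc_eqr z x y : same_coset U x y -> same_coset U z x = same_coset U z y.
Proof. by move=> xy; apply/idP/idP => zx; apply: sc_trans zx _; rewrite // sc_sym. Qed.

Lemma sc_eql z x y : same_coset U x y -> same_coset U x z = same_coset U y z.
Proof. by move=> xy; rewrite !(sc_sym _ z); exact: sc_eqr. Qed.

Lemma sc_mul g x y : same_coset U (g * x)%g (g * y)%g = same_coset U x y.
Proof. by rewrite /same_coset invgM mulgA mulgVK. Qed.

Lemma sc_mulV g x y : same_coset U (g^-1 * x)%g y = same_coset U x (g * y)%g.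
Proof. by rewrite -[LHS](sc_mul g) mulVKg. Qed.

Lemma transversal_shift s g : transversal U s -> transversal U [seq (g * x)%g | x <- s].
Proof.
case=> us sinj sex; split.
- by rewrite map_inj_uniq //; exact: mulgI.
- by move=> _ _ /mapP[y ys ->] /mapP[z zs ->]; rewrite sc_mul => /sinj ->.
- move=> x; have [y ys Uy] := sex (g^-1 * x)%g.
  by exists (g * y)%g; [exact: map_f | rewrite sc_sym -sc_mulV sc_sym].
Qed.

Variable A : nmodType.

Lemma sum_pick s x (c : A) : transversal U s ->
  \sum_(y <- s | same_coset U y x) c = c.
Proof.
case=> us sinj sex; have [y ys Uy] := sex x.
rewrite big_mkcond (bigD1_seq y) //= Uy big1_seq ?addr0 // => z /andP[zy zs].
case: ifP => // Uz; case/negP: zy; apply/eqP.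
by apply: sinj => //; apply: sc_trans Uz _; rewrite sc_sym.
Qed.

Lemma sum_transversal s t (f : G -> A) : transversal U s -> transversal U t ->
  (forall x y, same_coset U x y -> f x = f y) -> \sum_(x <- s) f x = \sum_(x <- t) f x.
Proof.
move=> ts tt fU.
under eq_bigr => x _ do rewrite -(sum_pick x (f x) tt).
rewrite (exchange_big_dep predT) //=; apply: eq_bigr => y _.
rewrite -[RHS](sum_pick y (f y) ts); apply: eq_big => [x|x]; first exact: sc_sym.
by move=> yx; rewrite (fU _ _ yx).
Qed.
End Cosets.

Section Reps.
Variable G : topGroupType.
Implicit Types (U V : openNormal G).

Lemma transversal_exists U : exists s : seq G, transversal U s.
Proof.
have [s0 s0P] := on_findex U; have sU := on_subgroup U.
pose e x := [pred y : G | same_coset U y x].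
pose f x := nth x s0 (find (e x) s0).
have hase x : has (e x) s0 by have [y ys Uy] := s0P x; apply/hasP; exists y.
have f1 x : same_coset U (f x) x by have := nth_find x (hase x).
have f2 x y : same_coset U x y -> f x = f y.
  move=> Uxy; have exy : e x =1 e y by move=> z; exact: sc_eqr.
  by rewrite /f (eq_find exy); apply: set_nth_default; rewrite -has_find.
exists (undup (map f s0)); split; first exact: undup_uniq.
- move=> y z; rewrite !mem_undup => /mapP[y0 y0s ->] /mapP[z0 z0s ->] Uyz.
  by apply: f2; rewrite -(sc_eql sU _ (f1 y0)) -(sc_eqr sU _ (f1 z0)).
- move=> x; exists (f x); last exact: f1.
  have [y ys Uy] := s0P x; rewrite mem_undup; apply/mapP; exists y => //.
  by apply/f2; rewrite sc_sym.
Qed.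

Definition reps U : seq G := projT1 (cid (transversal_exists U)).
Lemma repsP U : transversal U (reps U).
Proof. exact: projT2 (cid (transversal_exists U)). Qed.

Lemma sum_shift (A : nmodType) U (f : G -> A) g :
  (forall x y, same_coset U x y -> f x = f y) ->
  \sum_(x <- reps U) f (g * x)%g = \sum_(x <- reps U) f x.
Proof.
have sU := on_subgroup U => fU.
rewrite -(sum_transversal sU (transversal_shift sU g (repsP U)) (repsP U) fU).
by rewrite big_map.
Qed.

Lemma sc_sub U V x y : V `<=` U -> same_coset V x y -> same_coset U x y.
Proof. by move=> VU /asboolP Vxy; apply/asboolP/VU. Qed.

Lemma sc_invl U x y z : same_coset U x y -> same_coset U (x^-1 * z)%g (y^-1 * z)%g.
Proof.
rewrite (sc_sym (on_subgroup U)) => /asboolP Uyx; apply/asboolP.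
have := on_normal (y^-1 * z)%g Uyx.
by rewrite conjgE !invgM !invgK -!mulgA mulVKg.
Qed.
End Reps.

(* A[[G]] is the inverse limit of the group rings A[G/U].  The component in
   A[G/U] is given by the function sending g to the coefficient of gU. *)
Record cga (A : pzRingType) (G : topGroupType) := MkCga {
  cga_coef :> openNormal G -> G -> A;
  cga_inv : forall (U : openNormal G) x y, same_coset U x y -> cga_coef U x = cga_coef U y;
  cga_compat : forall U V : openNormal G, V `<=` U -> forall x,
    cga_coef U x = \sum_(y <- reps V | same_coset U x y) cga_coef V y }.

Section CgaRing.
Variables (A : pzRingType) (G : topGroupType).
Implicit Types (r s t : cga A G) (U V : openNormal G).

HB.instance Definition _ := gen_eqMixin (cga A G).
HB.instance Definition _ := gen_choiceMixin (cga A G).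

Lemma cga_ext r s : (forall U x, r U x = s U x) -> r = s.
Proof.
case: r s => [r r1 r2] [s s1 s2] /= rs.
have {}rs : r = s by apply: funext => U; apply: funext => x.
by move: r1 r2 s1 s2; rewrite rs => *; congr MkCga; exact: Prop_irrelevance.
Qed.

Definition cga_grp_coef (g : G) U x : A := if same_coset U g x then 1 else 0.
Fact cga_grp_inv g U x y : same_coset U x y -> cga_grp_coef g U x = cga_grp_coef g U y.
Proof. by move=> xy; rewrite /cga_grp_coef (sc_eqr (on_subgroup U) _ xy). Qed.
Fact cga_grp_compat g U V : V `<=` U -> forall x, cga_grp_coef g U x =
  \sum_(y <- reps V | same_coset U x y) cga_grp_coef g V y.
Proof.
have [sU sV] := (on_subgroup U, on_subgroup V).
move=> VU x; rewrite -[LHS](sum_pick sV g _ (repsP V)) big_mkcond [RHS]big_mkcond.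
apply: eq_bigr => y _; rewrite /cga_grp_coef (sc_sym sV).
case: ifP => [/(sc_sub VU) Uy|_]; last by rewrite if_same.
by rewrite (sc_sym sU) (sc_eqr sU x Uy).
Qed.
Definition cga_grp g : cga A G := MkCga (@cga_grp_inv g) (@cga_grp_compat g).

Fact cga_zero_inv U (x y : G) : same_coset U x y -> (0 : A) = 0. Proof. by []. Qed.
Fact cga_zero_compat U V : V `<=` U -> forall x,
  0 = \sum_(y <- reps V | same_coset U x y) 0 :> A.
Proof. by move=> _ x; rewrite big1. Qed.
Definition cga_zero : cga A G := @MkCga A G (fun _ _ => 0) cga_zero_inv cga_zero_compat.

Fact cga_opp_inv r U x y : same_coset U x y -> - r U x = - r U y.
Proof. by move=> /(cga_inv r) ->. Qed.
Fact cga_opp_compat r U V : V `<=` U -> forall x,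
  - r U x = \sum_(y <- reps V | same_coset U x y) - r V y.
Proof. by move=> VU x; rewrite (cga_compat r VU) raddf_sum. Qed.
Definition cga_opp r : cga A G := MkCga (@cga_opp_inv r) (@cga_opp_compat r).

Fact cga_add_inv r s U x y : same_coset U x y -> r U x + s U x = r U y + s U y.
Proof. by move=> xy; rewrite !(cga_inv _ xy). Qed.
Fact cga_add_compat r s U V : V `<=` U -> forall x, r U x + s U x =
  \sum_(y <- reps V | same_coset U x y) (r V y + s V y).
Proof. by move=> VU x; rewrite !(cga_compat _ VU) -big_split. Qed.
Definition cga_add r s : cga A G := MkCga (@cga_add_inv r s) (@cga_add_compat r s).

Definition cga_mul_coef r s U x := \sum_(y <- reps U) r U y * s U (y^-1 * x)%g.

Fact cga_mul_inv r s U x y : same_coset U x y -> cga_mul_coef r s U x = cga_mul_coef r s U y.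
Proof.
move=> xy; apply: eq_bigr => z _; congr (_ * _); apply: cga_inv.
by rewrite sc_mul.
Qed.

Fact cga_mul_compat r s U V : V `<=` U -> forall x, cga_mul_coef r s U x =
  \sum_(y <- reps V | same_coset U x y) cga_mul_coef r s V y.
Proof.
move=> VU x; have [sU sV] := (on_subgroup U, on_subgroup V).
transitivity (\sum_(y <- reps V) r V y * s U (y^-1 * x)%g).
  rewrite /cga_mul_coef; under eq_bigr => z _.
    rewrite (cga_compat r VU) mulr_suml.
    under eq_bigr => y zy do rewrite (cga_inv s (sc_invl x zy)).
    over.
  rewrite (exchange_big_dep predT) //=; apply: eq_bigr => y _.
  by rewrite (sum_pick sU y _ (repsP U)).
rewrite /cga_mul_coef (exchange_big_dep predT) //=; apply: eq_bigr => z _.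
rewrite -mulr_sumr; congr (_ * _); rewrite (cga_compat s VU).
rewrite big_mkcond [RHS]big_mkcond /=.
rewrite -(@sum_shift _ _ V _ z^-1%g); last first.
  by move=> y y' yy'; rewrite (cga_inv s yy') (sc_eqr sU _ (sc_sub VU yy')).
by apply: eq_bigr => y _; rewrite sc_mul andbT.
Qed.
Definition cga_mul r s : cga A G := MkCga (@cga_mul_inv r s) (@cga_mul_compat r s).

Fact cga_addA : associative cga_add.
Proof. by move=> r s t; apply: cga_ext => U x /=; rewrite addrA. Qed.
Fact cga_addC : commutative cga_add.
Proof. by move=> r s; apply: cga_ext => U x /=; rewrite addrC. Qed.
Fact cga_add0 : left_id cga_zero cga_add.
Proof. by move=> r; apply: cga_ext => U x /=; rewrite add0r. Qed.
Fact cga_addN : left_inverse cga_zero cga_opp cga_add.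
Proof. by move=> r; apply: cga_ext => U x /=; rewrite addNr. Qed.
HB.instance Definition _ :=
  GRing.isZmodule.Build (cga A G) cga_addA cga_addC cga_add0 cga_addN.

Fact cga_mulA : associative cga_mul.
Proof.
move=> r s t; apply: cga_ext => U x /=; rewrite /cga_mul_coef /=.
have sU := on_subgroup U.
under [RHS]eq_bigr => z _ do rewrite /cga_mul_coef mulr_suml.
rewrite exchange_big /=; apply: eq_bigr => y _.
rewrite /cga_mul_coef -(@sum_shift _ _ U _ y^-1%g); last first.
  move=> a b ab; rewrite (cga_inv s ab); congr (_ * _).
  exact/cga_inv/sc_invl.
rewrite mulr_sumr; apply: eq_bigr => z _; rewrite mulrA; congr (_ * _).
by congr (t U _); rewrite invgM invgK -mulgA mulVKg.
Qed.

Fact cga_mul1r : left_id (cga_grp 1%g) cga_mul.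
Proof.
move=> r; apply: cga_ext => U x /=; rewrite /cga_mul_coef /= /cga_grp_coef.
have sU := on_subgroup U.
rewrite -[RHS](sum_pick sU 1%g _ (repsP U)) [RHS]big_mkcond; apply: eq_bigr => y _.
rewrite (sc_sym sU); case: ifP => y1; rewrite ?mul0r // mul1r.
by rewrite (cga_inv r (sc_invl x y1)) invg1 mul1g.
Qed.

Fact cga_mulr1 : right_id (cga_grp 1%g) cga_mul.
Proof.
move=> r; apply: cga_ext => U x /=; rewrite /cga_mul_coef /= /cga_grp_coef.
have sU := on_subgroup U.
rewrite -[RHS](sum_pick sU x _ (repsP U)) [RHS]big_mkcond; apply: eq_bigr => y _.
rewrite (sc_sym sU) sc_mulV mulg1 (sc_sym sU).
by case: ifP => yx; rewrite ?mulr0 // mulr1 (cga_inv r yx).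
Qed.

Fact cga_mulDl : left_distributive cga_mul +%R.
Proof.
move=> r s t; apply: cga_ext => U x /=; rewrite /cga_mul_coef -big_split.
by apply: eq_bigr => y _; rewrite mulrDl.
Qed.
Fact cga_mulDr : right_distributive cga_mul +%R.
Proof.
move=> r s t; apply: cga_ext => U x /=; rewrite /cga_mul_coef -big_split.
by apply: eq_bigr => y _; rewrite mulrDr.
Qed.
HB.instance Definition _ := GRing.Zmodule_isPzRing.Build (cga A G)
  cga_mulA cga_mul1r cga_mulr1 cga_mulDl cga_mulDr.
End CgaRing.

HB.instance Definition _ (p : nat) (G : topGroupType) := Topological.copy (cga (Zp p) G)
  (initial_topology (fun r : cga (Zp p) G =>
     (fun Ug : openNormal G * G => r Ug.1 Ug.2) : {ptws openNormal G * G -> Zp p})).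

Section Inclusion.
Variables (A : pzRingType) (G : topGroupType) (H : subgroup G).
Implicit Types (U V : openNormal G) (l : cga A (subg H)).

Fact restr_open U : open [set x : subg H | on_set U (val x)].
Proof. by exists (on_set U); [exact: on_open|]. Qed.
Fact restr_subgroup U : subgroup_set [set x : subg H | on_set U (val x)].
Proof.
by have [U1 UM UV] := on_subgroup U; split=> [|x y|x]; [exact: U1|exact: UM|exact: UV].
Qed.
Fact restr_normal U (x y : subg H) : on_set U (val x) -> on_set U (val (x ^ y)%g).
Proof. exact: (@on_normal G U). Qed.
Fact restr_findex U : exists s : seq (subg H), forall x, exists2 y, y \in s &
  same_coset [set x : subg H | on_set U (val x)] y x.
Proof.
have [s sP] := on_findex U; have sU := on_subgroup U.
have [f fP] : exists f : G -> subg H, forall y (x : subg H),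
    same_coset U y (val x) -> same_coset U y (val (f y)).
  pose f y := xget 1%g [set x : subg H | same_coset U y (val x)].
  by exists f => y x yx; rewrite /f; case: xgetP => // /(_ x).
exists (map f s) => x; have [y ys yx] := sP (val x).
exists (f y); first exact: map_f.
suff : same_coset U (val (f y)) (val x) by [].
by apply: (sc_trans sU _ yx); rewrite (sc_sym sU); exact: fP yx.
Qed.
Definition restr U : openNormal (subg H) :=
  OpenNormal (restr_open U) (restr_subgroup U) (@restr_normal U) (restr_findex U).

Lemma sc_restr U x y : same_coset (restr U) x y = same_coset U (val x) (val y).
Proof. by []. Qed.

(* The coset of x in H/(H :&: U) goes to its image in G/U. *)
Definition cga_incl_coef l U g := \sum_(x <- reps (restr U) | same_coset U g (val x)) l (restr U) x.

Fact cga_incl_inv l U g h : same_coset U g h -> cga_incl_coef l U g = cga_incl_coef l U h.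
Proof. by move=> gh; apply: eq_bigl => x; exact: (sc_eql (on_subgroup U)). Qed.
Fact cga_incl_compat l U V : V `<=` U -> forall g,
  cga_incl_coef l U g = \sum_(y <- reps V | same_coset U g y) cga_incl_coef l V y.
Proof.
move=> VU g; have [sU sV] := (on_subgroup U, on_subgroup V).
have rVU : restr V `<=` restr U by move=> x; exact: VU.
transitivity (\sum_(x <- reps (restr V) | same_coset U g (val x)) l (restr V) x).
  rewrite /cga_incl_coef; under eq_bigr => x _ do rewrite (cga_compat l rVU).
  rewrite (exchange_big_dep (fun x => same_coset U g (val x))) /=; last first.
    by move=> x y gx; rewrite sc_restr => xy; exact: (sc_trans sU gx xy).
  apply: eq_bigr => x gx; rewrite -[RHS](sum_pick (on_subgroup (restr U)) x _ (repsP _)).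
  apply: eq_bigl => y; rewrite sc_restr andbC.
  by case xy : (same_coset U _ _); rewrite //= (sc_eqr sU _ xy).
rewrite /cga_incl_coef (exchange_big_dep (fun x => same_coset U g (val x))) /=; last first.
  by move=> y x gy /(sc_sub VU) yx; exact: (sc_trans sU gy yx).
apply: eq_bigr => x gx; rewrite -[LHS](sum_pick sV (val x) _ (repsP V)).
apply: eq_bigl => y; rewrite andbC.
by case yx : (same_coset V _ _); rewrite //= (sc_eqr sU _ (sc_sub VU yx)).
Qed.
Definition cga_incl l : cga A G := MkCga (@cga_incl_inv l) (@cga_incl_compat l).
End Inclusion.

(* A as an A[[G]]-module with trivial action of G: A[[G]] acts through the
   augmentation, its component at the one-element quotient G/G *)
Definition trivmod (A : pzRingType) (G : topGroupType) : Type := A.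

Section Trivial.
Variables (A : pzRingType) (G : topGroupType).
Local Notation trivmod := (trivmod A G).
HB.instance Definition _ := GRing.Zmodule.copy trivmod A.

Fact on_full_subgroup : subgroup_set [set: G]. Proof. by []. Qed.
Fact on_full_normal (x y : G) : [set: G] x -> [set: G] (x ^ y)%g. Proof. by []. Qed.
Fact on_full_findex : exists s : seq G, forall x, exists2 y, y \in s & same_coset [set: G] y x.
Proof. by exists [:: 1%g] => x; exists 1%g; [exact: mem_head | exact/asboolP]. Qed.
Definition on_full : openNormal G :=
  OpenNormal openT on_full_subgroup on_full_normal on_full_findex.

Definition aug (r : cga A G) : A := r on_full 1%g.

Lemma sc_full x y : same_coset on_full x y. Proof. exact/asboolP. Qed.

Lemma augM r s : aug (r * s) = aug r * aug s.
Proof.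
rewrite /aug /= /cga_mul_coef -[RHS](sum_pick on_full_subgroup 1%g _ (repsP on_full)).
rewrite [RHS]big_mkcond; apply: eq_bigr => y _; rewrite sc_full.
by rewrite (cga_inv r (sc_full y 1%g)) (cga_inv s (sc_full (y^-1 * 1)%g 1%g)).
Qed.
Definition triv_scale (r : cga A G) (a : trivmod) : trivmod := aug r * (a : A).
Fact triv_scaleA r s a : triv_scale r (triv_scale s a) = triv_scale (r * s) a.
Proof. by rewrite /triv_scale augM mulrA. Qed.
Fact triv_scale1 : left_id 1 triv_scale.
Proof. by move=> a; rewrite /triv_scale /aug /= /cga_grp_coef sc_full mul1r. Qed.
Fact triv_scaleDr : right_distributive triv_scale +%R.
Proof. by move=> r a b; exact: mulrDr. Qed.
Fact triv_scaleDl a : {morph triv_scale^~ a : r s / r + s}.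
Proof. by move=> r s; exact: mulrDl. Qed.
HB.instance Definition _ := GRing.Zmodule_isLmodule.Build (cga A G) trivmod
  triv_scaleA triv_scale1 triv_scaleDr triv_scaleDl.
End Trivial.

(* Algebraic extensions of Q are taken inside the algebraic closure algC. *)
Record is_subfield (F : set algC) : Prop := {
  subfield1 : F 1;
  subfieldB : forall x y, F x -> F y -> F (x - y);
  subfield_div : forall x y, F x -> F y -> F (x / y) }.

(* Gal(L/K): an automorphism of L over K is represented by its extension to
   algC by the identity outside L. *)
Record galgrp (L K : set algC) := GalGrp {
  gal_fun :> algC -> algC;
  gal_bij : bijective gal_fun;
  gal_out : forall x, ~ L x -> gal_fun x = x;
  gal_in : forall x, L x -> L (gal_fun x);
  gal_add : forall x y, L x -> L y -> gal_fun (x + y) = gal_fun x + gal_fun y;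
  gal_mul : forall x y, L x -> L y -> gal_fun (x * y) = gal_fun x * gal_fun y;
  gal_fix : forall x, K x -> gal_fun x = x }.

Section GalGroup.
Variables L K : set algC.
Implicit Types s t : galgrp L K.

Lemma gal_ext s t : s =1 t -> s = t.
Proof.
case: s t => [s s1 s2 s3 s4 s5 s6] [t t1 t2 t3 t4 t5 t6] /= /funext st.
by move: s1 s2 s3 s4 s5 s6; rewrite st => *; congr GalGrp; exact: Prop_irrelevance.
Qed.

HB.instance Definition _ := gen_eqMixin (galgrp L K).
HB.instance Definition _ := gen_choiceMixin (galgrp L K).

Definition gal_one : galgrp L K.
Proof. by refine (@GalGrp L K idfun _ _ _ _ _ _) => //; exists idfun. Defined.

Definition gal_comp s t : galgrp L K.
Proof.
refine (@GalGrp L K (s \o t) _ _ _ _ _ _) => /=.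
- exact: bij_comp (gal_bij s) (gal_bij t).
- by move=> x Lx; rewrite (gal_out t) // (gal_out s).
- by move=> x Lx; exact: (gal_in s (gal_in t Lx)).
- by move=> x y Lx Ly; rewrite (gal_add t) // (gal_add s) //; exact: gal_in.
- by move=> x y Lx Ly; rewrite (gal_mul t) // (gal_mul s) //; exact: gal_in.
- by move=> x Kx; rewrite (gal_fix t) // (gal_fix s).
Defined.

Lemma gal_inv_exists s : exists f, cancel s f /\ cancel f s.
Proof. by case: (gal_bij s) => f sf fs; exists f. Qed.
Definition gal_invf s := projT1 (cid (gal_inv_exists s)).
Lemma gal_funK s : cancel s (gal_invf s).
Proof. by rewrite /gal_invf; case: cid => f []. Qed.
Lemma gal_invfK s : cancel (gal_invf s) s.
Proof. by rewrite /gal_invf; case: cid => f []. Qed.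

Lemma gal_invf_in s x : L x -> L (gal_invf s x).
Proof.
move=> Lx; have [//|nL] := pselect (L (gal_invf s x)).
by exfalso; apply: (nL); rewrite -(gal_out s nL) gal_invfK.
Qed.

Definition gal_inv s : galgrp L K.
Proof.
refine (@GalGrp L K (gal_invf s) _ _ _ _ _ _) => /=.
- by exists s; [exact: gal_invfK | exact: gal_funK].
- by move=> x Lx; rewrite -{1}(gal_out s Lx) gal_funK.
- exact: gal_invf_in.
- move=> x y /(gal_invf_in s) Lx /(gal_invf_in s) Ly.
  by rewrite -{1}(gal_invfK s x) -{1}(gal_invfK s y) -(gal_add s) // gal_funK.
- move=> x y /(gal_invf_in s) Lx /(gal_invf_in s) Ly.
  by rewrite -{1}(gal_invfK s x) -{1}(gal_invfK s y) -(gal_mul s) // gal_funK.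
- by move=> x Kx; rewrite -{1}(gal_fix s Kx) gal_funK.
Defined.

Fact gal_compA : associative gal_comp. Proof. by move=> s t u; exact: gal_ext. Qed.
Fact gal_comp1 : left_id gal_one gal_comp. Proof. by move=> s; exact: gal_ext. Qed.
Fact gal_1comp : right_id gal_one gal_comp. Proof. by move=> s; exact: gal_ext. Qed.
Fact gal_compV : left_inverse gal_one gal_inv gal_comp.
Proof. by move=> s; apply: gal_ext => x; exact: gal_funK. Qed.
Fact gal_Vcomp : right_inverse gal_one gal_inv gal_comp.
Proof. by move=> s; apply: gal_ext => x; exact: gal_invfK. Qed.
HB.instance Definition _ := isGroup.Build (galgrp L K)
  gal_compA gal_comp1 gal_1comp gal_compV gal_Vcomp.

HB.instance Definition _ := Topological.copy (galgrp L K)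
  (initial_topology (@gal_fun L K : galgrp L K -> {ptws algC -> discrete_topology algC})).
End GalGroup.

Definition galois_ext (L K : set algC) : Prop :=
  [/\ is_subfield L, is_subfield K, K `<=` L &
      forall x, L x -> (forall s : galgrp L K, s x = x) -> K x].

Definition abelian_ext (L K : set algC) : Prop :=
  galois_ext L K /\ forall s t : galgrp L K, (s * t = t * s)%g.

Definition finite_ext (L F : set algC) : Prop :=
  [/\ is_subfield L, is_subfield F, F `<=` L &
      exists b : seq algC, forall x, L x <->
        exists2 c : nat -> algC, (forall i, F (c i)) & x = \sum_(i < size b) c i * b`_i].

Definition imaginary_quadratic (K : set algC) : Prop :=
  [/\ is_subfield K,
      exists b, [/\ K b, b \notin Crat &
        forall x, K x -> exists u v : rat, x = ratr u + ratr v * b] &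
      exists2 x, K x & x \isn't Num.real].

(* H is topologically isomorphic to Z_p^2; for open H, as used below, the last
   two conditions say that phi is a homeomorphism onto H. *)
Definition open_iso_Zp2 (p : nat) (G : topGroupType) (H : set G) : Prop :=
  exists phi : Zp p * Zp p -> G,
    [/\ {morph phi : a b / a + b >-> (a * b)%g}, injective phi, range phi = H,
        continuous phi & forall V, open V -> open (phi @` V)].

Definition Zp2_ext (p : nat) (L K : set algC) : Prop :=
  galois_ext L K /\ open_iso_Zp2 p [set: galgrp L K].

Definition pro_p (p : nat) (G : topGroupType) : Prop :=
  forall U : set G, open U -> subgroup_set U -> (forall x y, U x -> U (x ^ y)%g) ->
  exists s k, transversal U s /\ size s = (p ^ k)%N.

Definition ring_of_integers (F : set algC) : set algC := F `&` [set x | x \in Aint].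

Record is_nzprime (F P : set algC) : Prop := {
  nzprime_sub : P `<=` ring_of_integers F;
  nzprime0 : P 0;
  nzprimeD : forall x y, P x -> P y -> P (x + y);
  nzprimeM : forall a x, ring_of_integers F a -> P x -> P (a * x);
  nzprime_proper : ~ P 1;
  nzprime_prime : forall a b, ring_of_integers F a -> ring_of_integers F b ->
    P (a * b) -> P a \/ P b;
  nzprime_neq0 : exists2 x, P x & x != 0 }.

Definition ideal_mul (I J : set algC) : set algC :=
  [set x | exists2 s : seq (algC * algC), (forall u, u \in s -> I u.1 /\ J u.2) &
    x = \sum_(u <- s) u.1 * u.2].

Definition conj_ideal (P : set algC) : set algC := [set x^* | x in P].

Definition splits_as (p : nat) (K P P' : set algC) : Prop :=
  [/\ is_nzprime K P, is_nzprime K P', P <> P' &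
      ideal_mul P P' = [set p%:R * a | a in ring_of_integers K]].

(* Places of an imaginary quadratic field, which has a single infinite place *)
Inductive place := FinitePlace of set algC | InfinitePlace.

Definition is_place (K : set algC) (v : place) : Prop :=
  if v is FinitePlace P then is_nzprime K P else True.

(* The prime P of M ramifies in M/L when its inertia group in Gal(M/L) is
   nontrivial; this is meaningful for infinite algebraic extensions. *)
Definition inertia (M L P : set algC) : set (galgrp M L) :=
  [set s | forall x, ring_of_integers M x -> P (s x - x)].

Definition ramified (M L P : set algC) : Prop := exists2 s, @inertia M L P s & s <> 1%g.

Definition unramified_outside (K M L : set algC) (Sig : set place) : Prop :=
  forall P, is_nzprime M P -> ramified M L P -> Sig (FinitePlace (P `&` K)).

Definition abelian_prop_unramified_outside (p : nat) (K L : set algC) (Sig : set place)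
    (M : set algC) : Prop :=
  [/\ abelian_ext M L, pro_p p (galgrp M L) & unramified_outside K M L Sig].

Definition maximal_abelian_prop_unramified_outside (p : nat) (K L : set algC)
    (Sig : set place) (M : set algC) : Prop :=
  abelian_prop_unramified_outside p K L Sig M /\
  forall M', abelian_prop_unramified_outside p K L Sig M' -> M' `<=` M.

(* X is Gal(M/L) with its structure of compact Z_p[[Gal(L/K)]]-module, in which
   Gal(L/K) acts by conjugation with lifts to Gal(M/K).  As the group elements
   generate a dense subring, these conditions determine the module. *)
Definition is_galois_module (p : nat) (K L M : set algC)
    (X : lmodType (cga (Zp p) (galgrp L K))) : Prop :=
  exists (th : X -> galgrp M L) (th' : galgrp M L -> X),
    [/\ cancel th th', cancel th' th, {morph th : x y / x + y >-> (x * y)%g},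
        forall (x : X) (g : galgrp L K) (h : galgrp M K), (forall z, L z -> h z = g z) ->
          forall z, th (cga_grp (Zp p) g *: x) (h z) = h (th x z) &
        continuous (fun rs : cga (Zp p) (galgrp L K) * galgrp M L => th (rs.1 *: th' rs.2))].

Section Homological.
Variable R : pzRingType.
Implicit Types A B C M N P : lmodType R.

Definition exact_at A B C (f : {linear A -> B}) (g : {linear B -> C}) : Prop :=
  forall b, g b = 0 <-> exists a, f a = b.

Definition short_exact A B C : Prop :=
  exists (f : {linear A -> B}) (g : {linear B -> C}),
    [/\ injective f, exact_at f g & forall c, exists b, g b = c].

Definition projective P : Prop :=
  forall A B (g : {linear A -> B}) (f : {linear P -> B}), (forall b, exists a, g a = b) ->
  exists h : {linear P -> A}, forall x, g (h x) = f x.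

Record proj_resolution M := ProjResolution {
  res_mod :> nat -> lmodType R;
  res_d : forall n, {linear res_mod n.+1 -> res_mod n};
  res_eps : {linear res_mod 0 -> M};
  res_proj : forall n, projective (res_mod n);
  res_eps_surj : forall m, exists x, res_eps x = m;
  res_exact0 : exact_at (res_d 0) res_eps;
  res_exact : forall n, exact_at (res_d n.+1) (res_d n) }.

Definition pd_le (n : nat) M : Prop :=
  exists Q : proj_resolution M, forall k, (n < k)%N -> forall x : Q k, x = 0.

(* Ext^i(M, N) = 0: the cohomology of Hom(Q, N) in degree i vanishes, for a
   projective resolution Q of M, on the choice of which it does not depend. *)
Definition Ext_eq0 (i : nat) M N : Prop :=
  exists Q : proj_resolution M,
    match i with
    | 0 => forall u : {linear Q 0 -> N}, (forall x, u (res_d Q 0 x) = 0) -> forall x, u x = 0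
    | j.+1 => forall u : {linear Q j.+1 -> N}, (forall x, u (res_d Q j.+1 x) = 0) ->
        exists v : {linear Q j -> N}, forall x, u x = v (res_d Q j x)
    end.

Definition fin_gen M : Prop :=
  exists s : seq M, forall m, exists c : nat -> R, m = \sum_(i < size s) c i *: s`_i.

Definition torsion (S : set R) M : Prop := forall m : M, exists2 s, S s & s *: m = 0.

Definition inM (S : set R) M : Prop := fin_gen M /\ torsion S M.
Definition inC S M : Prop := inM S M /\ forall i, (2 <= i)%N -> Ext_eq0 i M R^o.
Definition inP S M : Prop := inM S M /\ pd_le 1 M.
Definition inQ S M : Prop := inM S M /\ exists n, pd_le n M.

Record modObj (T : lmodType R -> Prop) := ModObj { obj_mod :> lmodType R; obj_in : T obj_mod }.

Lemma inP_inC S M : inP S M -> inC S M.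
Proof.
move=> [MM [Q Q0]]; split=> // -[|[|i]] // _; exists Q => u _.
exists (\0%R : {linear Q i.+1 -> R^o}) => x.
by rewrite [x]Q0 // raddf0.
Qed.

Variable S : set R.
Definition C_to_M (A : modObj (inC S)) : modObj (inM S) := ModObj (proj1 (obj_in A)).
Definition P_to_C (A : modObj (inP S)) : modObj (inC S) := ModObj (inP_inC (obj_in A)).
Definition Q_to_M (A : modObj (inQ S)) : modObj (inM S) := ModObj (proj1 (obj_in A)).
End Homological.

(* The abelian group generated by the objects of P, with a relation for each
   short exact sequence.  Its elements are classes of words in the generators,
   (true, P) standing for [P] and (false, P) for -[P].  It is not declared as a
   zmodType because the objects of P form a type in a larger universe. *)
Section K0.
Variables (R : pzRingType) (S : set R).
Local Notation objP := (modObj (inP S)).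
Local Notation word := (seq (bool * objP)).

Inductive K0_rel : word -> word -> Prop :=
| K0_refl u : K0_rel u u
| K0_sym u v : K0_rel u v -> K0_rel v u
| K0_trans u v w : K0_rel u v -> K0_rel v w -> K0_rel u w
| K0_cat u u' v v' : K0_rel u u' -> K0_rel v v' -> K0_rel (u ++ v) (u' ++ v')
| K0_catC u v : K0_rel (u ++ v) (v ++ u)
| K0_cancel b P : K0_rel [:: (b, P); (~~ b, P)] [::]
| K0_exact (P' P P'' : objP) : short_exact P' P P'' ->
    K0_rel [:: (true, P)] [:: (true, P'); (true, P'')].

Record K0 := MkK0 { K0_class : word -> Prop; K0_classP : exists w, K0_class = K0_rel w }.

Definition K0_of (w : word) : K0 := MkK0 (ex_intro _ w erefl).
Definition K0_repr (x : K0) : word := projT1 (cid (K0_classP x)).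

Lemma K0_ofP u v : K0_of u = K0_of v <-> K0_rel u v.
Proof.
split=> [[->]|uv]; first exact: K0_refl.
have e : K0_rel u = K0_rel v.
  apply: funext => w; apply: propext; split.
    by apply: K0_trans; exact: K0_sym.
  exact: K0_trans.
rewrite /K0_of; move: (ex_intro _ _ _) (ex_intro _ _ _); rewrite e => h h'.
by congr MkK0; exact: Prop_irrelevance.
Qed.

Lemma K0_reprK x : K0_of (K0_repr x) = x.
Proof.
case: x => c cP; rewrite /K0_repr /=; case: cid => w /= wE.
by subst c; congr MkK0; exact: Prop_irrelevance.
Qed.

Definition K0_gen (P : objP) : K0 := K0_of [:: (true, P)].
Definition K0_add (x y : K0) : K0 := K0_of (K0_repr x ++ K0_repr y).
Definition K0_opp (x : K0) : K0 := K0_of [seq (~~ bP.1, bP.2) | bP <- K0_repr x].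
End K0.

HB.mixin Record Monoid_isCommutative Om of Monoid Om := {
  commonoidC : forall x y : Om, (x * y = y * x)%g }.
#[short(type="comMonoidType")]
HB.structure Definition ComMonoid := {Om of Monoid Om & Monoid_isCommutative Om}.

Definition invertible (Om : comMonoidType) (x : Om) : Prop := exists y, (x * y = 1)%g.

Record munits (Om : comMonoidType) := MUnit { munit_val : Om; munitP : invertible munit_val }.

Section Units.
Variable Om : comMonoidType.
Implicit Types x y : munits Om.

Lemma munit_ext x y : munit_val x = munit_val y -> x = y.
Proof.
by case: x y => [x xP] [y yP] /= xy; subst y; congr MUnit; exact: Prop_irrelevance.
Qed.

HB.instance Definition _ := gen_eqMixin (munits Om).
HB.instance Definition _ := gen_choiceMixin (munits Om).

Fact munit1_subproof : invertible (1%g : Om). Proof. by exists 1%g; rewrite mulg1. Qed.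
Definition munit1 := MUnit munit1_subproof.
Fact munitM_subproof x y : invertible (munit_val x * munit_val y)%g.
Proof.
have [[x' xx'] [y' yy']] := (munitP x, munitP y); exists (y' * x')%g.
by rewrite mulgA -[(munit_val x * _ * y')%g]mulgA yy' mulg1.
Qed.
Definition munitM x y := MUnit (munitM_subproof x y).
Definition munitVval x : Om := projT1 (cid (munitP x)).
Lemma munit_mulV x : (munit_val x * munitVval x = 1)%g.
Proof. exact: projT2 (cid (munitP x)). Qed.
Fact munitV_subproof x : invertible (munitVval x).
Proof. by exists (munit_val x); rewrite commonoidC munit_mulV. Qed.
Definition munitV x := MUnit (munitV_subproof x).

Fact munitMA : associative munitM. Proof. by move=> x y z; apply: munit_ext; exact: mulgA. Qed.
Fact munitM1 : left_id munit1 munitM. Proof. by move=> x; apply: munit_ext; exact: mul1g. Qed.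
Fact munit1M : right_id munit1 munitM. Proof. by move=> x; apply: munit_ext; exact: mulg1. Qed.
Fact munitMV : right_inverse munit1 munitV munitM.
Proof. by move=> x; apply: munit_ext; exact: munit_mulV. Qed.
Fact munitVM : left_inverse munit1 munitV munitM.
Proof. by move=> x; apply: munit_ext; rewrite /= commonoidC munit_mulV. Qed.
HB.instance Definition _ := isGroup.Build (munits Om) munitMA munitM1 munit1M munitVM munitMV.

Lemma munitMC x y : (x * y = y * x)%g.
Proof. by apply: munit_ext; exact: commonoidC. Qed.
End Units.

Definition expgz (G : groupType) (x : G) (n : int) : G :=
  match n with Posz m => x ^+ m | Negz m => x ^- m.+1 end%g.

Record quasiFitting (R : pzRingType) (S : set R) (Om : comMonoidType) := QuasiFitting {
  qf_fun :> modObj (inC S) -> Om;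
  qf_unit : forall P : modObj (inP S), invertible (qf_fun (P_to_C P));
  qf_exactr : forall (M' M : modObj (inC S)) (P : modObj (inP S)), short_exact M' M P ->
    qf_fun M = (qf_fun (P_to_C P) * qf_fun M')%g;
  qf_exactl : forall (P : modObj (inP S)) (M M' : modObj (inC S)), short_exact P M M' ->
    qf_fun M = (qf_fun (P_to_C P) * qf_fun M')%g }.

Section Induced.
Variables (R : pzRingType) (S : set R) (Om : comMonoidType) (F : quasiFitting S Om).
Implicit Types (P : modObj (inP S)) (x y : K0 S).

Definition qf_P P : munits Om := MUnit (qf_unit F P).

Definition qf_word (w : seq (bool * modObj (inP S))) : munits Om :=
  (\prod_(bP <- w) (if bP.1 then qf_P bP.2 else (qf_P bP.2)^-1))%g.

Lemma qf_word_cat u v : qf_word (u ++ v) = (qf_word u * qf_word v)%g.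
Proof. exact: big_cat. Qed.

Lemma qf_word_rel u v : K0_rel u v -> qf_word u = qf_word v.
Proof.
elim=> {u v} //.
- by move=> u v w _ -> _ ->.
- by move=> u u' v v' _ uu' _ vv'; rewrite !qf_word_cat uu' vv'.
- by move=> u v; rewrite !qf_word_cat munitMC.
- by move=> b P; rewrite /qf_word !big_cons !big_nil mulg1;
    case: b => /=; rewrite ?mulgV ?mulVg.
- move=> P' P P'' ex; rewrite /qf_word !big_cons !big_nil !mulg1 /= munitMC.
  by apply: munit_ext; exact: (qf_exactr F (M' := P_to_C P') (M := P_to_C P) (P := P'')).
Qed.

Definition qf_K0 x : munits Om := qf_word (K0_repr x).

Lemma qf_K0_of w : qf_K0 (K0_of w) = qf_word w.
Proof. by apply: qf_word_rel; apply/K0_ofP; exact: K0_reprK. Qed.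
Lemma qf_K0_gen P : qf_K0 (K0_gen P) = qf_P P.
Proof. by rewrite qf_K0_of /qf_word big_seq1. Qed.
Lemma qf_K0D x y : qf_K0 (K0_add x y) = (qf_K0 x * qf_K0 y)%g.
Proof. by rewrite qf_K0_of qf_word_cat. Qed.
Lemma qf_K0N x : qf_K0 (K0_opp x) = (qf_K0 x)^-1%g.
Proof.
rewrite qf_K0_of /qf_K0; elim: (K0_repr x) => [|[b P] w IH].
  by rewrite /qf_word !big_nil invg1.
rewrite /qf_word /= !big_cons -/(qf_word _) -/(qf_word w) IH invgM munitMC.
by congr (_ * _)%g; case: b => /=; rewrite ?invgK.
Qed.
End Induced.

Record is_shift (R : pzRingType) (S : set R) (Om : comMonoidType) (F : quasiFitting S Om)
    (Fs : int -> modObj (inM S) -> Om) : Prop := IsShift {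
  shift0 : forall M : modObj (inC S), Fs 0 (C_to_M M) = F M;
  shift_unit : forall n (P : modObj (inQ S)), invertible (Fs n (Q_to_M P));
  shift_exact : forall n (N M : modObj (inM S)) (P : modObj (inQ S)), short_exact N P M ->
    Fs n M = (Fs n (Q_to_M P) * Fs (n - 1) N)%g;
  shift_exactr : forall n (M' M : modObj (inM S)) (P : modObj (inQ S)), short_exact M' M P ->
    Fs n M = (Fs n (Q_to_M P) * Fs n M')%g;
  shift_exactl : forall n (P : modObj (inQ S)) (M M' : modObj (inM S)), short_exact P M M' ->
    Fs n M = (Fs n (Q_to_M P) * Fs n M')%g }.

(* S = Lambda \ {0} for Lambda = Z_p[[H]], as a subset of Z_p[[G]] *)
Definition Lambda_nz (p : nat) (G : topGroupType) (H : subgroup G) : set (cga (Zp p) G) :=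
  [set cga_incl l | l in [set l : cga (Zp p) (subg H) | l != 0]].

Definition Zp_triv (p : nat) (G : topGroupType) : lmodType (cga (Zp p) G) :=
  trivmod (Zp p) G.

Arguments Lambda_nz p {G} H.
Arguments Zp_triv p G : clear implicits.

(* Main.v *)
(* Split the four-term sequence at N = ker h = im g.  Two applications of the
   shift axiom give F<n+2>(Z_p) = F<n+2>(P2) F<n+1>(P1) F<n>(X), and the sequence
   0 -> P -> P -> 0 -> 0 gives F<n>(P) = F<n-1>(P)^-1, so F<n>(P) = F(P)^((-1)^n). *)
Require Import Defs.
From HB Require Import structures.
From mathcomp Require Import all_boot all_order all_algebra all_field.
From mathcomp Require Import all_classical.
From mathcomp Require Import topology.

Set Implicit Arguments.
Unset Strict Implicit.
Unset Printing Implicit Defensive.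

Import Order.TTheory GRing.Theory Num.Theory.

Local Open Scope classical_set_scope.
Local Open Scope ring_scope.

Section Kernel.
Variables (R : pzRingType) (A B : lmodType R) (h : {linear A -> B}).

(** The kernel is the middle module N at which the four-term sequence is cut. A boolean equation
    defines it, so that it is a subtype and inherits the module structure of [A]. *)
Definition kermod : Type := {x : A | h x == 0}.

HB.instance Definition _ := SubChoice.on kermod.

Fact kermod_submod : submod_closed [pred x : A | h x == 0].
Proof.
split=> [|a x y]; rewrite !inE ?raddf0 // => /eqP hx /eqP hy.
by rewrite linearP hx hy scaler0 addr0.
Qed.

HB.instance Definition _ := GRing.SubChoice_isSubLmodule.Build R A
  (fun x => h x == 0) kermod (GRing.submod_closed_semi kermod_submod).

Definition kermod_val : {linear kermod -> A} := \val.

Lemma kermod_val_inj : injective kermod_val. Proof. exact: val_inj. Qed.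

Lemma kermod_val_exact : exact_at kermod_val h.
Proof.
move=> x; split=> [/eqP hx|[y <-]]; last exact/eqP/(valP y).
by exists (Sub x hx); exact: SubK.
Qed.

Variables (C : lmodType R) (g : {linear C -> A}).
Hypothesis gh : exact_at g h.

Fact kermod_factor_subproof c : h (g c) == 0.
Proof. by apply/eqP/gh; exists c. Qed.
Definition kermod_factor_fun c : kermod := Sub (g c) (kermod_factor_subproof c).
Fact kermod_factor_linear : linear kermod_factor_fun.
Proof. by move=> a x y; apply: val_inj; rewrite /= linearP. Qed.
HB.instance Definition _ := GRing.isLinear.Build R C kermod *:%R
  kermod_factor_fun kermod_factor_linear.
Definition kermod_factor : {linear C -> kermod} := kermod_factor_fun.

Lemma kermod_factor_surj (x : kermod) : exists c, kermod_factor c = x.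
Proof.
have /eqP/gh[c gx] := valP x.
by exists c; exact: val_inj.
Qed.

(** Corestriction to [kermod] leaves the kernel of [g] unchanged, since [val] is injective. *)
Lemma kermod_factor_exact (D : lmodType R) (f : {linear D -> C}) : exact_at f g -> exact_at f kermod_factor.
Proof.
move=> fg c; rewrite -fg; split=> [/(congr1 val)//|gc].
exact: val_inj.
Qed.
End Kernel.

Section TorsionModules.
Variables (R : pzRingType) (S : set R).
Implicit Types A B : lmodType R.

(** Generators and annihilators both pass to quotients. This puts N in the category as a quotient of
    [P1]; finite generation of a submodule of [P2] would call for a Noetherian ring. *)
Lemma inM_image A B (g : {linear A -> B}) :
  (forall b, exists a, g a = b) -> inM S A -> inM S B.
Proof.
move=> g_surj [[s sP] torA]; split.
- exists (map g s) => b; have [a <-] := g_surj b; have [c ->] := sP a.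
  exists c; rewrite size_map linear_sum; apply: eq_bigr => i _.
  by rewrite linearZ (nth_map 0).
- move=> b; have [a <-] := g_surj b; have [r Sr ra] := torA a.
  by exists r => //; rewrite -linearZ ra raddf0.
Qed.

Lemma modObj_ext T (X Y : @modObj R T) : obj_mod X = obj_mod Y -> X = Y.
Proof.
by case: X Y => X XT [Y YT] /= XY; subst Y; congr ModObj; exact: Prop_irrelevance.
Qed.

Lemma inP_inQ A : inP S A -> inQ S A.
Proof. by case=> AM pdA; split=> //; exists 1%N. Qed.
Definition P_to_Q (P : modObj (inP S)) : modObj (inQ S) := ModObj (inP_inQ (obj_in P)).

(** The two routes from [inP] to [inM] keep the module but carry different membership proofs, and
    [Fs] takes the module together with its proof. *)
Lemma P_to_QM P : Q_to_M (P_to_Q P) = C_to_M (P_to_C P).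
Proof. exact: modObj_ext. Qed.

Lemma zero_module_exists A : inM S A -> exists2 Z : modObj (inM S),
  short_exact Z A A & short_exact A A Z.
Proof.
move=> AM; pose id_A : {linear A -> A} := idfun; pose zero_A : {linear A -> A} := \0%R.
have zi : exact_at zero_A id_A by move=> x; split=> [x0|[y <-] //]; exists 0; exact: esym x0.
have iz : exact_at id_A zero_A by move=> x; split=> // _; exists x.
(* The zero module is realised as the kernel of the identity of [A]; it is a quotient of [A] through
   the corestricted zero map. *)
have ZM := inM_image (kermod_factor_surj zi) AM.
exists (ModObj ZM).
- exists (kermod_val id_A), id_A; split; first exact: kermod_val_inj.
    exact: kermod_val_exact.
  by move=> x; exists x.
- exists id_A, (kermod_factor zi); split=> //; first exact: kermod_factor_exact.
  exact: kermod_factor_surj.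
Qed.
End TorsionModules.

(** With an equivalence as the step, one relation between consecutive shifts reaches the negative
    integers too. *)
Lemma int_ind_pred (Q : int -> Prop) :
  Q 0 -> (forall n, Q (n - 1) <-> Q n) -> forall n, Q n.
Proof.
move=> Q0 QP; apply: int_rec => [//|n /= Qn|n /= Qn].
  by apply/QP; rewrite -addn1 PoszD addrK.
by move/QP: Qn; rewrite -opprD -PoszD addn1.
Qed.

Lemma signz_pred (n : int) : (-1) ^ n = - (-1) ^ (n - 1) :> int.
Proof. by have := exprzDr (unitrN1 int) (n - 1) 1; rewrite subrK expr1z mulrN1. Qed.

Section Sign.
Variable G : groupType.
Implicit Types (x : G) (n : int).

Lemma expgzN x n : expgz x (- n) = (expgz x n)^-1%g.
Proof. by case: n => [[|n]|n] /=; rewrite ?expg0 ?invg1 // ?opprK ?invgK. Qed.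

Lemma expgzV x n : expgz x^-1%g n = (expgz x n)^-1%g.
Proof. by case: n => n /=; rewrite expVgn. Qed.

Lemma expgz_sign_pred x n : expgz x ((-1) ^ n) = (expgz x ((-1) ^ (n - 1)))^-1%g.
Proof. by rewrite signz_pred expgzN. Qed.

(** Passing from [n - 1] to [n] inverts both sides, and inversion is multiplicative in a commutative
    group. *)
Lemma expgz_signM x y n : (forall x y : G, x * y = y * x)%g ->
  expgz (x * y)%g ((-1) ^ n) = (expgz x ((-1) ^ n) * expgz y ((-1) ^ n))%g.
Proof.
move=> GC; elim/int_ind_pred: n => [|n]; first by rewrite expr0z /= !expg1.
rewrite !(expgz_sign_pred _ n).
by rewrite -invgM (GC (expgz y _)); split=> [->|/invg_inj].
Qed.
End Sign.

Section Shift.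
Variables (R : pzRingType) (S : set R) (Om : comMonoidType) (F : quasiFitting S Om).
Variable Fs : int -> modObj (inM S) -> Om.
Hypothesis Fs_shift : is_shift F Fs.
Implicit Types P : modObj (inP S).

Lemma shift_P_mul_pred n P :
  (Fs n (C_to_M (P_to_C P)) * Fs (n - 1) (C_to_M (P_to_C P)) = 1)%g.
Proof.
have [Z ZPP PPZ] := zero_module_exists (proj1 (obj_in P)).
(* The sequence 0 -> 0 -> P -> P -> 0 is taken at level [m + 1] because [shift_exact] lowers the
   index of the left term by one; the unit [Fs (m + 1)] of P then cancels. *)
have FZ m : Fs m Z = 1%g.
  have [u uP] := shift_unit Fs_shift (m + 1) (P_to_Q P).
  have := shift_exact Fs_shift (m + 1) (N := Z) (M := Q_to_M (P_to_Q P))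
    (P := P_to_Q P) ZPP.
  move=> /(congr1 (fun x => u * x)%g).
  by rewrite mulgA (commonoidC u) uP mul1g addrK => ->.
rewrite -P_to_QM -(FZ n); symmetry; exact: (shift_exact Fs_shift).
Qed.

(** On both sides the values at [n] and [n - 1] are mutually inverse. Inverses in [Om] are unique,
    so equality at one index is equivalent to equality at the other, and [n = 0] is the axiom
    [shift0]. *)
Lemma shift_P n P :
  Fs n (C_to_M (P_to_C P)) = munit_val (expgz (qf_P F P) ((-1) ^ n)).
Proof.
have stepP m : munit_val (expgz (qf_P F P) ((-1) ^ m)) =
    munit_val (expgz (qf_P F P) ((-1) ^ (m - 1)))^-1%g by rewrite -expgz_sign_pred.
have canc (a b c : Om) : (a * b = 1 -> a * c = 1 -> b = c)%g.
  by move=> ab ac; rewrite -[b]mulg1 -ac mulgA (commonoidC b) ab mul1g.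
have sgn m : (munit_val (expgz (qf_P F P) ((-1) ^ m)) *
    munit_val (expgz (qf_P F P) ((-1) ^ (m - 1))) = 1)%g.
  by rewrite stepP commonoidC munit_mulV.
elim/int_ind_pred: n => [|n].
  by rewrite (shift0 Fs_shift).
have := shift_P_mul_pred n P; have := sgn n.
set a := munit_val _; set b := munit_val _; set c := Fs n _; set d := Fs _ _.
move=> ab cd; split=> [dE|cE]; last by apply: (canc c) => //; rewrite cE.
by apply: (canc d); rewrite commonoidC // dE.
Qed.

Lemma shift_four_term (n : int) (X Z : modObj (inM S)) P1 P2
    (f : {linear X -> P1}) (g : {linear P1 -> P2}) (h : {linear P2 -> Z}) :
  injective f -> exact_at f g -> exact_at g h -> (forall z, exists y, h y = z) ->
  Fs (n + 2) Z = (Fs (n + 2) (C_to_M (P_to_C P2)) *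
    (Fs (n + 1) (C_to_M (P_to_C P1)) * Fs n X))%g.
Proof.
move=> f_inj fg gh h_surj.
have NM := inM_image (kermod_factor_surj gh) (proj1 (obj_in P1)).
have XPN : short_exact X P1 (ModObj NM).
  exists f, (kermod_factor gh); split=> //; first exact: kermod_factor_exact.
  exact: kermod_factor_surj.
have NPZ : short_exact (ModObj NM) P2 Z.
  exists (kermod_val h), h; split=> //; exact: kermod_val_exact.
have := shift_exact Fs_shift (n + 2) (P := P_to_Q P2) NPZ.
have := shift_exact Fs_shift (n + 1) (P := P_to_Q P1) XPN.
by rewrite !P_to_QM addrK (_ : n + 2 - 1 = n + 1) -?addrA // => ->.
Qed.
End Shift.

Theorem theorem5p16
  (p : nat) (p_prime : prime p) (p_odd : odd p)
  (K : set algC) (K_iq : imaginary_quadratic K)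
  (pp : set algC) (p_split : splits_as p K pp (conj_ideal pp))
  (Kt : set algC) (Kt_Zp2 : Zp2_ext p Kt K)
  (L : set algC) (L_ab : abelian_ext L K) (L_fin : finite_ext L Kt)
  (Sigma : set place) (Sigma_fin : finite_set Sigma)
  (Sigma_pl : forall v, Sigma v -> is_place K v)
  (Sigma_p : forall P, is_nzprime K P -> P p%:R -> Sigma (FinitePlace P))
  (Sigma_ram : unramified_outside K L K Sigma)
  (M : set algC)
  (M_max : maximal_abelian_prop_unramified_outside p K L
             (Sigma `\ FinitePlace (conj_ideal pp)) M)
  (G' : subgroup (galgrp L K)) (G'_open : open (G' : set (galgrp L K)))
  (G'_Zp2 : open_iso_Zp2 p (G' : set (galgrp L K)))
  (X : modObj (inC (Lambda_nz p G'))) (X_gal : is_galois_module M X)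
  (Z_inM : inM (Lambda_nz p G') (Zp_triv p (galgrp L K)))
  (P1 P2 : modObj (inP (Lambda_nz p G')))
  (f : {linear X -> P1}) (g : {linear P1 -> P2}) (h : {linear P2 -> Zp_triv p (galgrp L K)})
  (f_inj : injective f) (fg_exact : exact_at f g) (gh_exact : exact_at g h)
  (h_surj : forall z, exists y, h y = z)
  (Om : comMonoidType) (F : quasiFitting (Lambda_nz p G') Om)
  (Fs : int -> modObj (inM (Lambda_nz p G')) -> Om) (Fs_shift : is_shift F Fs) :
  let Phi := K0_add (K0_gen P1) (K0_opp (K0_gen P2)) in
  (forall n : int,
     Fs n (C_to_M X) =
     (munit_val (expgz (qf_K0 F Phi) ((-1) ^ n)%R) * Fs (n + 2)%R (ModObj Z_inM))%g) /\
  F X = (munit_val (qf_K0 F Phi) * Fs 2 (ModObj Z_inM))%g.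
Proof.
move=> Phi.
have main n : Fs n (C_to_M X) =
    (munit_val (expgz (qf_K0 F Phi) ((-1) ^ n)%R) * Fs (n + 2)%R (ModObj Z_inM))%g.
  (* The right-hand side is expanded down to [Fs n] of [X], so that only unit factors remain to be
     cancelled. *)
  rewrite (shift_four_term Fs_shift (X := C_to_M X) (Z := ModObj Z_inM)
    n f_inj fg_exact gh_exact h_surj) !(shift_P Fs_shift).
  rewrite qf_K0D qf_K0N !qf_K0_gen expgz_signM; last exact: munitMC.
  rewrite expgzV; set a := qf_P F P1; set b := qf_P F P2.
  (* Two shifts keep the sign of the exponent for [P2], while the single shift for [P1] reverses
     it. *)
  have -> : expgz b ((-1) ^ (n + 2)) = expgz b ((-1) ^ n).
    by rewrite exprzDr ?unitrN1 // mulr1.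
  have -> : expgz a ((-1) ^ (n + 1)) = (expgz a ((-1) ^ n))^-1%g.
    by rewrite expgz_sign_pred addrK.
  set u := expgz a _; set v := expgz b _.
  rewrite !mulgA -[LHS]mul1g; congr (_ * _)%g.
  (* The product of values in [Om] is read as the value of a product in [munits Om], where the group
     laws apply. *)
  change (1%g = munit_val (u * v^-1 * v * u^-1)%g).
  by rewrite mulgVK mulgV.
split=> //; have := main 0.
by rewrite (shift0 Fs_shift) expr0z /= expg1 add0r.
Qed.
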